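(* Let $d\ge 1$ and let $[C_1,\dots,C_d]$ be the Cesàro tuple acting on the Drury-Arveson space $H^2_d(\mathbb{B}_d)$. Then for every $1\le j\le d$ the operator norm of $C_j$ on $H^2_d(\mathbb{B}_d)$ satisfies $\|C_j\|=2$.
   Context: Multi-index notation: for $\alpha=(\alpha_1,\dots,\alpha_d)\in\mathbb{N}^d$ (with $0\in\mathbb{N}$), $z^\alpha=\prod_i z_i^{\alpha_i}$, $\alpha!=\prod_i\alpha_i!$, $|\alpha|=\sum_i\alpha_i$. The Drury-Arveson space $H^2_d=H^2_d(\mathbb{B}_d)$ is the reproducing kernel Hilbert space of analytic functions on the unit ball $\mathbb{B}_d\subset\mathbb{C}^d$ with kernel $k(z,w)=\frac{1}{1-\langle z,w\rangle}$. Equivalently, it consists of the power series $f(z)=\sum_\alpha c_\alpha z^\alpha$ with $\|f\|^2=\sum_\alpha |c_\alpha|^2\frac{\alpha!}{|\alpha|!}<\infty$, with inner product $\langle f,g\rangle=\sum_\alpha\frac{\alpha!}{|\alpha|!}c_\alpha\overline{d_\alpha}$ for $g=\sum_\alpha d_\alpha z^\alpha$. The monomials $z^\alpha$ form an orthogonal basis. Each $f\in H^2_d$ has a homogeneous expansion $f=\sum_{n\ge0}f_n$ with $f_n(z)=\sum_{|\alpha|=n}c_\alpha z^\alpha$. The Cesàro tuple $[C_1,\dots,C_d]$ consists of the bounded operators on $H^2_d$ defined, for $1\le j\le d$, by $$C_jf=\sum_{n=0}^\infty\frac{1}{n+1}\sum_{m=0}^n z_j^{\,n-m}f_m = f_0+\tfrac12(z_jf_0+f_1)+\tfrac13(z_j^2f_0+z_jf_1+f_2)+\cdots.$$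 Equivalently, $C_jz^\alpha=\sum_{k=0}^\infty\frac{1}{|\alpha|+k+1}z^{\alpha+ke_j}$, where $e_j$ is the $j$-th standard basis multi-index. *)

(* Defs.v *)
From HB Require Import structures.
From mathcomp Require Import all_boot all_order all_algebra.
From mathcomp Require Import complex.
From mathcomp Require Import all_classical all_reals all_analysis.

Set Implicit Arguments.
Unset Strict Implicit.
Unset Printing Implicit Defensive.

Import Order.TTheory GRing.Theory Num.Theory.

Local Open Scope classical_set_scope.
Local Open Scope ring_scope.
Local Open Scope complex_scope.

Definition multi_index (d : nat) := {ffun 'I_d -> nat}.

Definition mi_deg (d : nat) (a : multi_index d) : nat := (\sum_(i < d) a i)%N.

Definition mi_fact (d : nat) (a : multi_index d) : nat :=
  (\prod_(i < d) (a i)`!)%N.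

Definition mi_addX (d : nat) (j : 'I_d) (k : nat) (a : multi_index d) :
  multi_index d := [ffun i => (a i + (i == j) * k)%N].

(* Truncated: this is a - k e_j only when k <= a j. *)
Definition mi_subX (d : nat) (j : 'I_d) (k : nat) (a : multi_index d) :
  multi_index d := [ffun i => (a i - (i == j) * k)%N].

(* The power series \sum_a f(a) z^a, given by its coefficients. *)
Definition power_series (R : realType) (d : nat) := multi_index d -> R[i].

Definition monomial (R : realType) (d : nat) (a : multi_index d) :
  power_series R d := fun b => (b == a)%:R.

Definition mulX (R : realType) (d : nat) (j : 'I_d) (k : nat)
  (f : power_series R d) : power_series R d :=
  fun b => if (k <= b j)%N then f (mi_subX j k b) else 0.

Definition hom_part (R : realType) (d : nat) (n : nat)
  (f : power_series R d) : power_series R d :=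
  fun b => if mi_deg b == n then f b else 0.

Definition da_weight (R : realType) (d : nat) (a : multi_index d) : R :=
  (mi_fact a)%:R / ((mi_deg a)`!)%:R.

(* Extended-real valued, equal to +oo exactly outside the Drury-Arveson
   space. *)
Definition da_norm (R : realType) (d : nat) (f : power_series R d) : \bar R :=
  sqrte (\esum_(a in [set: multi_index d])
           (Normc.normc (f a) ^+ 2 * da_weight R a)%:E)%E.

Definition drury_arveson (R : realType) (d : nat) : set (power_series R d) :=
  [set f | (da_norm f < +oo)%E].

(* +oo if T is unbounded, or maps some element of the unit ball outside the
   space. *)
Definition da_opnorm (R : realType) (d : nat)
  (T : power_series R d -> power_series R d) : \bar R :=
  ereal_sup [set da_norm (T f) | f in
    [set f | drury_arveson f /\ (da_norm f <= 1)%E]].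

Definition cesaro_term (R : realType) (d : nat) (j : 'I_d)
  (f : power_series R d) (n : nat) : power_series R d :=
  fun b => (n.+1%:R)^-1 * \sum_(m < n.+1) mulX j (n - m) (hom_part m f) b.

(* C_j f = \sum_n cesaro_term j f n.  The n-th term is homogeneous of degree
   n, so only n = mi_deg b contributes to the coefficient of z^b. *)
Definition cesaro_op (R : realType) (d : nat) (j : 'I_d)
  (f : power_series R d) : power_series R d :=
  fun b => cesaro_term j f (mi_deg b) b.

Lemma mi_deg_subX (d : nat) (j : 'I_d) (k : nat) (a : multi_index d) :
  (k <= a j)%N -> mi_deg (mi_subX j k a) = (mi_deg a - k)%N.
Proof.
move=> kj; rewrite /mi_deg (bigD1 j)//= [in RHS](bigD1 j)//= ffunE eqxx mul1n.
rewrite addnBAC//; congr (_ + _ - _)%N.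
by apply: eq_bigr => i /negbTE ij; rewrite ffunE ij mul0n subn0.
Qed.

Lemma hom_part_cesaro_term (R : realType) (d : nat) (j : 'I_d)
  (f : power_series R d) (n k : nat) :
  hom_part k (cesaro_term j f n) = if k == n then cesaro_term j f n else cst 0.
Proof.
have homn b : mi_deg b != n -> cesaro_term j f n b = 0.
  move=> bn; rewrite /cesaro_term big1 ?mulr0// => m _.
  rewrite /mulX /hom_part; case: ifPn => // jb; case: eqP => // h.
  have le : (n - m <= mi_deg b)%N.
    by rewrite (leq_trans jb)// /mi_deg (bigD1 j)//= leq_addr.
  case/eqP: bn; have := ltn_ord m; rewrite ltnS => mn.
  by rewrite mi_deg_subX// in h; rewrite -(subnK le) h subnKC.
apply/funext => b; rewrite /hom_part; case: eqP => [<-|bk].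
  by case: eqP => // /eqP bn; rewrite homn.
by case: eqP => // kn; rewrite homn// -kn; apply/eqP.
Qed.

Lemma hom_part_cesaro (R : realType) (d : nat) (j : 'I_d)
  (f : power_series R d) (n : nat) :
  hom_part n (cesaro_op j f) = cesaro_term j f n.
Proof.
have := hom_part_cesaro_term j f n n; rewrite eqxx => <-.
by apply/funext => b; rewrite /hom_part /cesaro_op; case: eqP => // ->.
Qed.

Lemma cesaro_monomial (R : realType) (d : nat) (j : 'I_d)
  (a : multi_index d) (k : nat) :
  cesaro_op j (monomial R a) (mi_addX j k a) = ((mi_deg a + k).+1%:R)^-1.
Proof.
have dE : mi_deg (mi_addX j k a) = (mi_deg a + k)%N.
  rewrite /mi_deg (bigD1 j)//= [in RHS](bigD1 j)//= ffunE eqxx mul1n.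
  rewrite addnAC; congr (_ + _ + _)%N.
  by apply: eq_bigr => i /negbTE ij; rewrite ffunE ij mul0n addn0.
have sE : mi_subX j k (mi_addX j k a) = a.
  by apply/ffunP => i; rewrite !ffunE addnK.
rewrite /cesaro_op /cesaro_term dE; set n := (mi_deg a + k)%N.
have an : (mi_deg a < n.+1)%N by rewrite ltnS leq_addr.
rewrite (bigD1 (Ordinal an))//= big1 ?addr0; last first.
  move=> m mE; rewrite /mulX /hom_part /monomial; case: ifPn => // _.
  case: eqP => // h; case: eqP => // e; case/eqP: mE; apply: val_inj => /=.
  by rewrite -h e.
rewrite /n addKn /mulX /hom_part /monomial sE !eqxx ffunE eqxx mul1n.
by rewrite leq_addl mulr1.
Qed.

Lemma cesaro_monomial0 (R : realType) (d : nat) (j : 'I_d)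
  (a b : multi_index d) :
  (forall k, b != mi_addX j k a) -> cesaro_op j (monomial R a) b = 0.
Proof.
move=> ab; rewrite /cesaro_op /cesaro_term big1 ?mulr0// => m _.
rewrite /mulX /hom_part /monomial; case: ifPn => // kb; case: eqP => // _.
case: eqP => // aE; case/eqP: (ab (mi_deg b - m)%N); apply/ffunP => i.
rewrite -aE !ffunE; case: (eqVneq i j) => [->|]; last by rewrite !mul0n subn0 addn0.
by rewrite !mul1n subnK.
Qed.

(* Main.v *)
(** On the monomials z^(a + n e_j), n >= 0, with a_j = 0 fixed, C_j sends the
coefficients c_0, c_1, ... to (c_0 + ... + c_n) / (|a| + n + 1), a bound for
which is the usual Cesaro mean; the squared norms of these monomials do not
increase with n. Hardy's inequality with exponent 2 and constant 4 persists for
nonincreasing weights, so ||C_j|| <= 2. On the line a = 0 all weights are 1 and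
C_j is the Cesaro operator of l^2: on the truncations of c_n = 1/sqrt(n+1) the
n-th mean is 2 c_n + O(1/(n+1)), and the divergence of the harmonic series
makes the error negligible. *)
Require Import Defs.
From mathcomp Require Import all_boot all_order all_algebra.
From mathcomp Require Import complex.
From mathcomp Require Import all_classical all_reals all_analysis.
From mathcomp Require Import ring lra.

Set Implicit Arguments.
Unset Strict Implicit.
Unset Printing Implicit Defensive.

Import Order.TTheory GRing.Theory Num.Theory.

Local Open Scope classical_set_scope.
Local Open Scope ring_scope.
Local Open Scope complex_scope.

(** * Hardy's inequality with nonincreasing weights *)

Lemma weighted_hardy (R : realFieldType) (w a : nat -> R) (N : nat) :
  (forall n, 0 <= w n) -> (forall n, w n.+1 <= w n) ->
  \sum_(n < N) w n * (n.+1%:R^-1 * \sum_(i < n.+1) a i) ^+ 2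
    <= 4 * \sum_(n < N) w n * a n ^+ 2.
Proof.
move=> w0 wS; pose A n := n.+1%:R^-1 * \sum_(i < n.+1) a i.
have AS n : n.+2%:R * A n.+1 = n.+1%:R * A n + a n.+1.
  by rewrite /A !mulVKf ?pnatr_eq0// [LHS]big_ord_recr.
case: N => [|N]; first by rewrite !big_ord0 mulr0.
(* The second summand absorbs the cross terms and makes the induction go. *)
suff : \sum_(n < N.+1) w n * A n ^+ 2 + 2 * N.+1%:R * w N * A N ^+ 2
    <= 4 * \sum_(n < N.+1) w n * a n ^+ 2.
  apply: le_trans; rewrite lerDl.
  by rewrite mulr_ge0 ?sqr_ge0// mulr_ge0// mulr_ge0// ler0n.
elim: N => [|N IH].
  rewrite !big_ord_recr !big_ord0 /= /A big_ord_recr big_ord0/= !add0r invr1.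
  by have := mulr_ge0 (w0 0%N) (sqr_ge0 (a 0%N)); rewrite mul1r; nra.
rewrite big_ord_recr/= [X in _ <= _ * X]big_ord_recr/=.
(* The coefficient [2 * N.+1%:R + 3] is [1 + 2 * N.+2%:R]: the new summand together with the new
   correction term. By the recurrence [AS], the difference of the two sides is a sum of two squares
   with nonnegative coefficients. *)
have key : (2 * N.+1%:R + 3) * A N.+1 ^+ 2 - 4 * a N.+1 ^+ 2
    <= 2 * N.+1%:R * A N ^+ 2.
  have aE : a N.+1 = (N.+1%:R + 1) * A N.+1 - N.+1%:R * A N.
    by have := AS N; rewrite -(natr1 N.+1) => ->; ring.
  rewrite -subr_ge0 [X in 0 <= X](_ : _ = (A N.+1 - 2 * a N.+1) ^+ 2
    + 2 * N.+1%:R * (A N - A N.+1) ^+ 2); last by rewrite aE; ring.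
  by rewrite addr_ge0 ?sqr_ge0// mulr_ge0 ?sqr_ge0// mulr_ge0 ?ler0n.
have := ler_wpM2l (w0 N.+1) key.
(* Monotonicity of the weights enters here, to reach the correction term present in [IH]. *)
have : w N.+1 * (2 * N.+1%:R * A N ^+ 2) <= w N * (2 * N.+1%:R * A N ^+ 2).
  by rewrite ler_wpM2r// mulr_ge0 ?sqr_ge0// mulr_ge0 ?ler0n.
move: IH; rewrite -(natr1 N.+1); lra.
Qed.

(** * Multi-indices along lines in direction [j] *)

Lemma mi_deg_addX (d : nat) (j : 'I_d) (k : nat) (a : multi_index d) :
  mi_deg (mi_addX j k a) = (mi_deg a + k)%N.
Proof.
rewrite /mi_deg (bigD1 j)//= [in RHS](bigD1 j)//= ffunE eqxx mul1n.
rewrite addnAC; congr (_ + _ + _)%N.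
by apply: eq_bigr => i /negbTE ij; rewrite ffunE ij mul0n addn0.
Qed.

Lemma mi_deg0 (d : nat) : mi_deg ([ffun => 0%N] : multi_index d) = 0%N.
Proof. by rewrite /mi_deg big1// => i _; rewrite ffunE. Qed.

Lemma mi_fact_addXS (d : nat) (j : 'I_d) (k : nat) (a : multi_index d) :
  mi_fact (mi_addX j k.+1 a) = ((a j + k).+1 * mi_fact (mi_addX j k a))%N.
Proof.
rewrite /mi_fact (bigD1 j)//= [in RHS](bigD1 j)//= mulnA.
congr (_ * _)%N; first by rewrite !ffunE eqxx !mul1n addnS factS.
by apply: eq_bigr => i /negbTE ij; rewrite !ffunE ij !mul0n.
Qed.

Lemma da_weight_ge0 (R : realType) (d : nat) (a : multi_index d) :
  0 <= da_weight R a.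
Proof. by rewrite /da_weight divr_ge0 ?ler0n. Qed.

(** The ratio of the two weights is [(a j + k + 1) / (mi_deg a + k + 1)], and [a j] is one of the
    summands of the degree. *)
Lemma da_weight_addXS (R : realType) (d : nat) (j : 'I_d) (k : nat)
    (a : multi_index d) :
  da_weight R (mi_addX j k.+1 a) <= da_weight R (mi_addX j k a).
Proof.
rewrite /da_weight mi_fact_addXS !mi_deg_addX addnS factS !natrM invfM.
rewrite mulrACA ler_piMl ?divr_ge0 ?ler0n// ler_pdivrMr ?ltr0n// mul1r ler_nat.
by rewrite ltnS leq_add2r /mi_deg (bigD1 j)//= leq_addr.
Qed.

Lemma mi_subX_addX (d : nat) (j : 'I_d) (k n : nat) (a : multi_index d) :
  mi_subX j k (mi_addX j (n + k) a) = mi_addX j n a.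
Proof.
apply/ffunP => i; rewrite !ffunE; case: eqP => _.
  by rewrite !mul1n addnA addnK.
by rewrite !mul0n !addn0 subn0.
Qed.

Lemma mi_addX_inj (d : nat) (j : 'I_d) (a : multi_index d) :
  injective (mi_addX j ^~ a).
Proof.
by move=> m n /ffunP/(_ j); rewrite !ffunE eqxx !mul1n => /addnI.
Qed.

Lemma cesaro_op_line (R : realType) (d : nat) (j : 'I_d) (f : power_series R d)
    (n : nat) (a : multi_index d) : a j = 0%N ->
  cesaro_op j f (mi_addX j n a) =
  (mi_deg a + n).+1%:R^-1 * \sum_(i < n.+1) f (mi_addX j i a).
Proof.
move=> aj; rewrite /cesaro_op /cesaro_term mi_deg_addX; congr (_ * _).
set s := mi_deg a; set b := mi_addX j n a.
have bj : b j = n by rewrite ffunE eqxx mul1n aj.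
rewrite -(big_mkord xpredT (fun m => mulX j (s + n - m) (hom_part m f) b)).
(* For [m < s] the shift [s + n - m] exceeds [b j = n], so [mulX] returns 0; the remaining indices
   are [m = s + i] with [i <= n]. *)
rewrite (@big_cat_nat _ _ _ s)//=; last by rewrite -addnS leq_addr.
rewrite big_nat_cond big1 ?add0r; last first.
  move=> m; rewrite andbT => /= ms; rewrite /mulX bj ifN//.
  by rewrite -ltnNge ltn_subRL ltn_add2r.
rewrite -[X in index_iota X _]add0n big_addn -(addnS s n) addKn big_mkord.
apply: eq_bigr => i _; rewrite (addnC i) subnDA addKn /mulX bj leq_subr.
have le : (i <= n)%N by rewrite -ltnS.
rewrite /b -[X in mi_addX _ X](subnKC le) mi_subX_addX /hom_part.
by rewrite mi_deg_addX addnC eqxx.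
Qed.

(** Each [b] lies on exactly one line: its base point is [b] with the [j]-th entry set to 0, and its
    position there is [b j]. Nonnegativity permits the rearrangement. *)
Lemma esum_lines (R : realType) (d : nat) (j : 'I_d)
    (F : multi_index d -> \bar R) : (forall b, 0 <= F b)%E ->
  (\esum_(b in [set: multi_index d]) F b =
   \esum_(a in [set a : multi_index d | a j = 0%N])
     \sum_(n <oo) F (mi_addX j n a))%E.
Proof.
move=> F0; under [RHS]eq_esum do rewrite nneseries_esumT//.
rewrite esum_esum//.
rewrite (reindex_esum
  ([set a : multi_index d | a j = 0%N] `*`` fun=> [set: nat]) _
  (fun p => mi_addX j p.2 p.1))//.
split => //.
- move=> [a m] [b n]; rewrite !inE/= => -[aj _] [bj _] e.
  have mn : m = n.
    by move/ffunP/(_ j): e; rewrite !ffunE eqxx !mul1n aj bj.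
  congr pair => //; apply/ffunP => i; move/ffunP/(_ i): e.
  by rewrite !ffunE mn => /addIn.
- move=> b _; exists ([ffun i => if i == j then 0%N else b i], b j).
    by split => //=; rewrite ffunE eqxx.
  apply/ffunP => i; rewrite !ffunE/=; case: eqP => [->|_].
    by rewrite mul1n.
  by rewrite mul0n addn0.
Qed.

(** * Complex moduli and the upper bound *)

Lemma normc_sum (R : rcfType) (n : nat) (F : 'I_n -> R[i]) :
  Normc.normc (\sum_(i < n) F i) <= \sum_(i < n) Normc.normc (F i).
Proof.
elim/big_ind2 : _ => //; first by rewrite Normc.normc0.
by move=> x1 x2 y1 y2 h1 h2; rewrite (le_trans (le_normcD _ _))// lerD.
Qed.

Lemma normc_ge0 (R : rcfType) (z : R[i]) : 0 <= Normc.normc z.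
Proof. by case: z => x y; exact: sqrtr_ge0. Qed.

Lemma normcR (R : rcfType) (x : R) : Normc.normc x%:C = `|x|.
Proof. by rewrite /Normc.normc/= expr0n/= addr0 sqrtr_sqr. Qed.

Lemma invrnC (R : rcfType) (n : nat) : (n%:R : R[i])^-1 = (n%:R^-1)%:C.
Proof. by rewrite fmorphV rmorph_nat. Qed.

Lemma sum_real_complex (R : rcfType) (n : nat) (F : 'I_n -> R) :
  (\sum_(i < n) F i)%:C = \sum_(i < n) (F i)%:C.
Proof. exact: rmorph_sum. Qed.

Definition da_term (R : realType) (d : nat) (f : power_series R d)
  (b : multi_index d) : R := Normc.normc (f b) ^+ 2 * da_weight R b.

Lemma da_term_ge0 (R : realType) (d : nat) (f : power_series R d)
  (b : multi_index d) : 0 <= da_term f b.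
Proof. by rewrite mulr_ge0 ?sqr_ge0// da_weight_ge0. Qed.

(** Hardy's inequality is applied to the moduli of the coefficients, after the triangle inequality
    and the replacement of [1 / (mi_deg a + n + 1)] by the larger [1 / (n + 1)]. *)
Lemma da_term_cesaro_line (R : realType) (d : nat) (j : 'I_d)
    (f : power_series R d) (a : multi_index d) (N : nat) : a j = 0%N ->
  \sum_(n < N) da_term (cesaro_op j f) (mi_addX j n a)
    <= 4 * \sum_(n < N) da_term f (mi_addX j n a).
Proof.
move=> aj; pose c n := Normc.normc (f (mi_addX j n a)).
have := weighted_hardy c N (fun n => da_weight_ge0 R (mi_addX j n a))
  (fun n => da_weight_addXS R j n a).
under [X in _ <= _ * X -> _]eq_bigr do rewrite mulrC.
apply: le_trans; apply: ler_sum => n _; rewrite /da_term mulrC.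
rewrite ler_wpM2l ?da_weight_ge0// cesaro_op_line// Normc.normcM.
rewrite invrnC normcR ger0_norm ?invr_ge0 ?ler0n// lerXn2r ?nnegrE//.
- by rewrite mulr_ge0 ?invr_ge0 ?ler0n ?normc_ge0.
- by rewrite mulr_ge0 ?invr_ge0 ?ler0n ?sumr_ge0// => i _; exact: normc_ge0.
- rewrite ler_pM ?invr_ge0 ?ler0n ?normc_ge0//; last exact: normc_sum.
  by rewrite lef_pV2 ?posrE ?ltr0n// ler_nat ltnS leq_addl.
Qed.

Lemma le_esumZl (R : realType) (T : choiceType) (D : set T) (F : T -> \bar R)
    (r : R) : 0 <= r -> (forall i, 0 <= F i)%E ->
  (\esum_(i in D) (r%:E * F i) <= r%:E * \esum_(i in D) F i)%E.
Proof.
move=> r0 F0; apply: ge_ereal_sup => _ [X XD <-].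
rewrite -ge0_mule_fsumr//; apply: lee_wpmul2l; first by rewrite lee_fin.
by apply: ereal_sup_ubound; exists X.
Qed.

(** The constant 4 does not depend on the line or on the truncation, so the estimate passes to the
    limit on each line and then to the sum over all lines. *)
Lemma esum_da_term_cesaro (R : realType) (d : nat) (j : 'I_d)
    (f : power_series R d) :
  (\esum_(b in [set: multi_index d]) (da_term (cesaro_op j f) b)%:E
    <= 4%:R%:E * \esum_(b in [set: multi_index d]) (da_term f b)%:E)%E.
Proof.
have t0 (g : power_series R d) b : (0 <= (da_term g b)%:E)%E.
  by rewrite lee_fin da_term_ge0.
rewrite !(esum_lines j)//.
apply: le_trans (le_esumZl _ _ _) => //; last first.
  by move=> a; apply: nneseries_ge0.
apply: le_esum => a /= aj; apply: lime_le; first exact: is_cvg_nneseries.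
apply: nearW => N; rewrite big_mkord sumEFin.
apply: (@le_trans _ _ (4 * \sum_(n < N) da_term f (mi_addX j n a))%:E).
  by rewrite lee_fin da_term_cesaro_line.
rewrite EFinM lee_wpmul2l ?lee_fin// -sumEFin.
by rewrite -(big_mkord xpredT (fun n => (da_term f (mi_addX j n a))%:E))
  nneseries_lim_ge.
Qed.

Lemma da_norm_cesaro (R : realType) (d : nat) (j : 'I_d)
    (f : power_series R d) :
  (da_norm (cesaro_op j f) <= 2%:R%:E * da_norm f)%E.
Proof.
have -> : (2%:R%:E = sqrte 4%:R%:E :> \bar R)%E.
  by rewrite /= (_ : 4%:R = 2 ^+ 2) ?sqrtr_sqr ?ger0_norm// -natrX.
rewrite -sqrteM ?lee_fin// lee_sqrt ?esum_da_term_cesaro//.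
rewrite mule_ge0 ?lee_fin// esum_ge0// => b _.
by rewrite lee_fin da_term_ge0.
Qed.

(** * Sums of inverse square roots and the harmonic series *)

Lemma sum_invsqrt_ge (R : rcfType) (n : nat) :
  2 * (Num.sqrt n.+1%:R - 1) <= \sum_(i < n) (Num.sqrt i.+1%:R)^-1 :> R.
Proof.
elim: n => [|n IH]; first by rewrite big_ord0 sqrtr1 subrr mulr0.
rewrite big_ord_recr/=; move: IH.
set x := Num.sqrt n.+1%:R; set y := Num.sqrt n.+2%:R => IH.
have x0 : 0 < x by rewrite sqrtr_gt0 ltr0n.
have x2 : x ^+ 2 = n.+1%:R by rewrite sqr_sqrtr ?ler0n.
have y2 : y ^+ 2 = x ^+ 2 + 1 by rewrite x2 sqr_sqrtr ?ler0n// natr1.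
(* Since [y ^+ 2 - x ^+ 2 = 1], the product [2 * x * (y - x)] equals [1 - (y - x) ^+ 2]. *)
suff : 2 * (y - x) <= x^-1 by lra.
by rewrite -div1r ler_pdivlMr//; have := sqr_ge0 (x - y); nra.
Qed.

Lemma sum_invsqrt3_le (R : rcfType) (n : nat) :
  \sum_(i < n) (Num.sqrt i.+1%:R)^-1 ^+ 3 <= 3 :> R.
Proof.
case: n => [|n]; first by rewrite big_ord0.
(* The added term dominates the tail of the series and makes the left side nonincreasing in [n]; its
   value at [n = 0] is [1 + 2 = 3]. *)
suff : \sum_(i < n.+1) (Num.sqrt i.+1%:R)^-1 ^+ 3 + 2 * (Num.sqrt n.+1%:R)^-1
    <= 3 :> R.
  by apply: le_trans; rewrite lerDl mulr_ge0// invr_ge0 sqrtr_ge0.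
elim: n => [|n IH].
  by rewrite big_ord_recr big_ord0/= sqrtr1 invr1 expr1n; lra.
rewrite big_ord_recr/=; move: IH.
set x := Num.sqrt n.+1%:R; set y := Num.sqrt n.+2%:R => IH.
have x0 : 0 < x by rewrite sqrtr_gt0 ltr0n.
have y0 : 0 < y by rewrite sqrtr_gt0 ltr0n.
have x2 : x ^+ 2 = n.+1%:R by rewrite sqr_sqrtr ?ler0n.
have y2 : y ^+ 2 = x ^+ 2 + 1 by rewrite x2 sqr_sqrtr ?ler0n// natr1.
have xy : x <= y by rewrite ler_sqrt ?ler_nat// ltr0n.
(* The right side will be [2 / (x * y * (x + y))], and [x <= y] gives
   [x * y * (x + y) <= 2 * y ^+ 3]. *)
suff : y^-1 ^+ 3 <= 2 * (x^-1 - y^-1) by lra.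
have -> : x^-1 - y^-1 = (x * y * (x + y))^-1.
  have : (y - x) * (x + y) = 1.
    by transitivity (y ^+ 2 - x ^+ 2); [|rewrite y2]; ring.
  have ? : x + y != 0 by rewrite gt_eqF// addr_gt0.
  have ? : x != 0 by rewrite gt_eqF.
  have ? : y != 0 by rewrite gt_eqF.
  move=> e; rewrite -[RHS]mul1r -e; field.
  exact/and3P.
rewrite -[2]invrK -invfM exprVn lef_pV2 ?posrE ?mulr_gt0 ?invr_gt0 ?exprn_gt0//;
  last exact: addr_gt0.
by rewrite mulrC ler_pdivrMr//; nra.
Qed.

(** With [u = 1 / sqrt (n + 1)] the mean is at least [2 * (u - u ^+ 2)], whose square is at least
    [4 * u ^+ 2 - 8 * u ^+ 3]. The cubes sum to at most 3, hence [24 = 8 * 3]. *)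
Lemma sum_cesaro_invsqrt_ge (R : realType) (N : nat) :
  4 * series harmonic N - 24 <=
  \sum_(n < N) (n.+1%:R^-1 * \sum_(i < n.+1) (Num.sqrt i.+1%:R)^-1) ^+ 2 :> R.
Proof.
have := sum_invsqrt3_le R N => h3.
rewrite /series/= big_mkord.
apply: (@le_trans _ _ (4 * \sum_(n < N) n.+1%:R^-1
   - 8 * \sum_(n < N) (Num.sqrt n.+1%:R)^-1 ^+ 3)); first by lra.
rewrite !mulr_sumr -sumrB; apply: ler_sum => n _.
have := sum_invsqrt_ge R n.+1; set S := \sum_(i < n.+1) _ => hS.
set x : R := Num.sqrt n.+1%:R.
have x1 : 1 <= x by rewrite -sqrtr1 ler_sqrt ?ler1n// ltr0n.
have x2 : n.+1%:R = x ^+ 2 by rewrite sqr_sqrtr ?ler0n.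
have xS : 2 * (x - 1) <= S.
  by apply: le_trans hS; rewrite ler_pM2l// lerB// ler_sqrt ?ler_nat// ltr0n.
rewrite x2 exprMn; set u := x^-1.
have ux : u * x = 1 by rewrite mulVf// gt_eqF// (lt_le_trans _ x1).
have -> : (x ^+ 2)^-1 = u ^+ 2 by rewrite exprVn.
apply: (@le_trans _ _ ((u ^+ 2) ^+ 2 * (2 * (x - 1)) ^+ 2)).
  have -> : (u ^+ 2) ^+ 2 * (2 * (x - 1)) ^+ 2 = 4 * (u * (u * x - u)) ^+ 2.
    by ring.
  by rewrite ux; have := sqr_ge0 (u ^+ 2); nra.
rewrite ler_wpM2l ?sqr_ge0// lerXn2r// nnegrE; last apply: le_trans xS.
  by rewrite mulr_ge0// subr_ge0.
by rewrite mulr_ge0// subr_ge0.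
Qed.

Lemma harmonic_series_unbounded (R : realType) (M : R) :
  exists N, M < series harmonic N.
Proof.
apply: contrapT => /forallNP h; apply: (@dvg_harmonic R).
apply: nondecreasing_is_cvgn.
  by apply: nondecreasing_series => i _ _; exact: harmonic_ge0.
by exists M => _ [N _ <-]; rewrite leNgt; apply/negP/h.
Qed.

(** * Test functions supported on a coordinate axis *)

Definition mi_axis (d : nat) (j : 'I_d) (n : nat) : multi_index d :=
  mi_addX j n [ffun => 0%N].

Lemma da_weight_axis (R : realType) (d : nat) (j : 'I_d) (n : nat) :
  da_weight R (mi_axis j n) = 1.
Proof.
rewrite /da_weight mi_deg_addX mi_deg0 add0n (_ : mi_fact _ = n`!).
  by rewrite divff// pnatr_eq0 -lt0n fact_gt0.
rewrite /mi_fact (bigD1 j)//= big1 ?muln1 => [|i /negbTE ij].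
  by rewrite !ffunE eqxx mul1n.
by rewrite !ffunE ij mul0n.
Qed.

Lemma esum_axis (R : realType) (d : nat) (j : 'I_d) (N : nat)
    (F : multi_index d -> \bar R) : (forall b, 0 <= F b)%E ->
  (\esum_(b in mi_axis j @` `I_N) F b = \sum_(n < N) F (mi_axis j n))%E.
Proof.
move=> F0; rewrite esum_image; last by move=> m n _ _; exact: mi_addX_inj.
by rewrite esum_fset// (fsbig_ord _ _ (fun n => F (mi_axis j n))).
Qed.

(* The sum over n < N of z_j^n / sqrt (n + 1), divided by its norm. *)
Definition extremal (R : realType) (d : nat) (j : 'I_d) (N : nat) :
    power_series R d :=
  fun b => if b \in mi_axis j @` `I_N
           then ((Num.sqrt (series harmonic N))^-1
                 * (Num.sqrt (b j).+1%:R)^-1)%:C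
           else 0.

Lemma extremal_axis (R : realType) (d : nat) (j : 'I_d) (N n : nat) :
  (n < N)%N -> extremal R j N (mi_axis j n) =
  ((Num.sqrt (series harmonic N))^-1 * (Num.sqrt n.+1%:R)^-1)%:C.
Proof.
move=> nN; rewrite /extremal mem_set; last by exists n.
by rewrite !ffunE eqxx mul1n.
Qed.

Lemma da_norm_extremal (R : realType) (d : nat) (j : 'I_d) (N : nat) :
  0 < series harmonic N :> R -> da_norm (extremal R j N) = 1%:E.
Proof.
move=> H0; rewrite /da_norm.
rewrite (_ : esum _ _ = \esum_(b in mi_axis j @` `I_N)
    (da_term (extremal R j N) b)%:E); last first.
  rewrite [RHS]esum_mkcond; apply: eq_esum => b _.
  rewrite /da_term /extremal; case: ifP => // _.
  by rewrite Normc.normc0 expr0n mul0r.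
rewrite esum_axis => [|b]; last by rewrite lee_fin da_term_ge0.
rewrite sumEFin (_ : \sum_(n < N) _ = 1) /= ?sqrtr1//.
transitivity ((series harmonic N)^-1 * series harmonic N : R).
  rewrite [X in _ = _ * X]/series/= big_mkord mulr_sumr.
  apply: eq_bigr => n _; rewrite /da_term da_weight_axis mulr1 extremal_axis//.
  by rewrite normcR real_normK ?num_real// exprMn !exprVn !sqr_sqrtr// ltW.
by rewrite mulVf// gt_eqF.
Qed.

(** Only the coefficients at positions [n < N] of the axis are kept. Their means involve positions
    [i <= n < N], which the truncation does not touch. *)
Lemma da_norm_cesaro_extremal (R : realType) (d : nat) (j : 'I_d) (N : nat) :
  0 < series harmonic N :> R ->
  ((Num.sqrt (4 - 24 / series harmonic N))%:E
    <= da_norm (cesaro_op j (extremal R j N)))%E.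
Proof.
move=> H0; set H := series harmonic N in H0 *.
have t0 b : (0 <= (da_term (cesaro_op j (extremal R j N)) b)%:E)%E.
  by rewrite lee_fin da_term_ge0.
(* For [H < 6] the radicand is negative and its square root is 0 by convention, so the bound remains
   true. *)
rewrite -[X in (X <= _)%E]/(sqrte (4 - 24 / H)%:E) lee_sqrt; last first.
  by apply: esum_ge0 => b _; exact: t0.
apply: (@le_trans _ _ (\esum_(b in mi_axis j @` `I_N)
  (da_term (cesaro_op j (extremal R j N)) b)%:E)%E); last first.
  rewrite esum_mkcond; apply: le_esum => b _.
  by case: ifP => _; rewrite ?lexx ?t0.
rewrite esum_axis// sumEFin lee_fin.
apply: (@le_trans _ _ (H^-1 * (4 * H - 24))).
  by rewrite mulrBr mulrCA mulVf ?gt_eqF// mulr1 [H^-1 * _]mulrC.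
apply: (@le_trans _ _ (H^-1 * \sum_(n < N)
    (n.+1%:R^-1 * \sum_(i < n.+1) (Num.sqrt i.+1%:R)^-1) ^+ 2)).
  apply: ler_wpM2l; last exact: sum_cesaro_invsqrt_ge.
  by rewrite invr_ge0 ltW.
rewrite mulr_sumr; apply: ler_sum => n _.
rewrite /da_term da_weight_axis mulr1 cesaro_op_line ?ffunE//.
have -> : \sum_(i < n.+1) extremal R j N (mi_addX j i [ffun=> 0%N]) =
    ((Num.sqrt H)^-1 * \sum_(i < n.+1) (Num.sqrt i.+1%:R)^-1)%:C.
  rewrite mulr_sumr sum_real_complex; apply: eq_bigr => i _.
  exact: (extremal_axis R j (leq_ltn_trans (leq_ord i) (ltn_ord n))).
rewrite mi_deg0 add0n invrnC -rmorphM normcR real_normK ?num_real//.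
rewrite [X in _ <= X ^+ 2]mulrCA [leRHS]exprMn exprVn sqr_sqrtr//.
exact: ltW.
Qed.

(** * Comparison of the two bounds *)

Theorem theorem2p5 (R : realType) (d : nat) (hd : (1 <= d)%N) (j : 'I_d) :
  da_opnorm (@cesaro_op R d j) = (2%:R%:E)%E.
Proof.
apply/eqP; rewrite eq_le; apply/andP; split.
  apply: ge_ereal_sup => _ [f [_ f1] <-].
  apply: le_trans (da_norm_cesaro j f) _.
  by rewrite -[leRHS]mule1 lee_wpmul2l ?lee_fin.
have lb N : 0 < series harmonic N :> R ->
    ((Num.sqrt (4 - 24 / series harmonic N))%:E
      <= da_opnorm (@cesaro_op R d j))%E.
  move=> H0; apply: le_trans (da_norm_cesaro_extremal j H0) _.
  apply: ereal_sup_ubound; exists (extremal R j N) => //.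
  by rewrite /drury_arveson/= da_norm_extremal// ltry lexx.
rewrite leNgt; apply/negP => lt2.
(* Any positive partial sum serves here: its lower bound rules out the value [-oo] and gives
   [0 <= r]. *)
have [N1 hN1] := harmonic_series_unbounded (0 : R).
move: lb lt2; case: (da_opnorm _) => [r||] lb lt2 //; last first.
  by have := lb _ hN1; rewrite leeNy_eq.
have r2 : r < 2 by rewrite -lte_fin.
have r0 : 0 <= r by have := lb _ hN1; rewrite lee_fin; apply: le_trans.
(* The threshold is the solution [H] of [4 - 24 / H = r ^+ 2]. *)
have [N hN] := harmonic_series_unbounded (24 / (4 - r ^+ 2)).
have r4 : 0 < 4 - r ^+ 2 by nra.
have H0 : 0 < series harmonic N :> R by apply: lt_trans hN; rewrite divr_gt0.
have r2H : r ^+ 2 < 4 - 24 / series harmonic N.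
  rewrite ltrBrDr -ltrBrDl ltr_pdivrMr//.
  by move: hN; rewrite ltr_pdivrMr// mulrC.
have := lb _ H0; rewrite lee_fin leNgt => /negP; apply.
by rewrite -(ger0_norm r0) -sqrtr_sqr ltr_sqrt// (le_lt_trans (sqr_ge0 r)).
Qed.
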